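(* Let $\mu_1,\mu_2\in[-\pi,\pi)$, $\kappa_1,\kappa_2\ge 0$, $\kappa_3\in\mathbb{R}$, and let $(\Theta,\Phi)$ have either the bivariate von Mises sine distribution or the bivariate von Mises cosine distribution with parameters $\kappa_1,\kappa_2,\kappa_3,\mu_1,\mu_2$. Then the Fisher-Lee and Jammalamadaka-Sarma circular correlation coefficients satisfy $$\rho_{\mathrm{FL}}(\Theta,\Phi)=\delta\big(\cos(\Theta-\mu_1),\cos(\Phi-\mu_2)\big)\,\rho_{\mathrm{JS}}(\Theta,\Phi),$$ where $\delta(X,Y)=E(XY)/\sqrt{E(X^2)E(Y^2)}$. In particular, $|\rho_{\mathrm{FL}}(\Theta,\Phi)|\le|\rho_{\mathrm{JS}}(\Theta,\Phi)|$.
   Context: Both distributions are supported on $[-\pi,\pi)^2$, with parameters $\kappa_1,\kappa_2\ge0$, $\kappa_3\in\mathbb{R}$, $\mu_1,\mu_2\in[-\pi,\pi)$. Von Mises sine distribution: density proportional to $$\exp[\kappa_1\cos(\theta-\mu_1)+\kappa_2\cos(\phi-\mu_2)+\kappa_3\sin(\theta-\mu_1)\sin(\phi-\mu_2)].$$ Von Mises cosine distribution: density proportional to $$\exp[\kappa_1\cos(\theta-\mu_1)+\kappa_2\cos(\phi-\mu_2)+\kappa_3\cos(\theta-\mu_1-\phi+\mu_2)].$$ Fisher-Lee coefficient: with $(\Theta_1,\Phi_1),(\Theta_2,\Phi_2)$ i.i.d. copies of $(\Theta,\Phi)$, $$\rho_{\mathrm{FL}}(\Theta,\Phi)=\frac{E[\sin(\Theta_1-\Theta_2)\sin(\Phi_1-\Phi_2)]}{\sqrt{E[\sin^2(\Theta_1-\Theta_2)]\,E[\sin^2(\Phi_1-\Phi_2)]}}.$$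 Jammalamadaka-Sarma coefficient: $$\rho_{\mathrm{JS}}(\Theta,\Phi)=\frac{E[\sin(\Theta-\mu_1)\sin(\Phi-\mu_2)]}{\sqrt{E[\sin^2(\Theta-\mu_1)]\,E[\sin^2(\Phi-\mu_2)]}},$$ where the location parameters $\mu_1,\mu_2$ of the model serve as the circular means of $\Theta,\Phi$. *)

(* Defs.v *)
From HB Require Import structures.
From mathcomp Require Import all_boot all_order all_algebra.
From mathcomp Require Import all_classical all_reals all_analysis.

Set Implicit Arguments.
Unset Strict Implicit.
Unset Printing Implicit Defensive.

Import Order.TTheory GRing.Theory Num.Theory.
Import numFieldNormedType.Exports.

Local Open Scope classical_set_scope.
Local Open Scope ring_scope.

Section densities.
Context {R : realType}.

Definition torus_square : set (R * R) := `[- pi, pi[ `*` `[- pi, pi[.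

Definition vm_sine_kernel (k1 k2 k3 mu1 mu2 : R) (z : R * R) : R :=
  expR (k1 * cos (z.1 - mu1) + k2 * cos (z.2 - mu2)
        + k3 * sin (z.1 - mu1) * sin (z.2 - mu2)).

Definition vm_cosine_kernel (k1 k2 k3 mu1 mu2 : R) (z : R * R) : R :=
  expR (k1 * cos (z.1 - mu1) + k2 * cos (z.2 - mu2)
        + k3 * cos (z.1 - mu1 - z.2 + mu2)).

End densities.

Section laws.
Context {d : measure_display} {T : measurableType d} {R : realType}.
Variable P : probability T R.

(* The normalising constant c is determined by P having total mass 1. *)
Definition has_density_proportional_to (Theta Phi : {RV P >-> R})
    (f : R * R -> R) : Prop :=
  exists2 c : R, 0 < c &
    forall A : set (R * R), measurable A ->
      P [set w | A (Theta w, Phi w)] =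
      (\int[lebesgue_measure \x lebesgue_measure]_(z in A `&` torus_square)
         (c * f z)%:E)%E.

Definition von_mises_sine (k1 k2 k3 mu1 mu2 : R)
    (Theta Phi : {RV P >-> R}) : Prop :=
  has_density_proportional_to Theta Phi (vm_sine_kernel k1 k2 k3 mu1 mu2).

Definition von_mises_cosine (k1 k2 k3 mu1 mu2 : R)
    (Theta Phi : {RV P >-> R}) : Prop :=
  has_density_proportional_to Theta Phi (vm_cosine_kernel k1 k2 k3 mu1 mu2).

End laws.

Section coefficients.
Context {d : measure_display} {T : measurableType d} {R : realType}.
Variable P : probability T R.

(* 'E_P is extended-real valued. It is only used here for bounded variables,
   whose expectations are finite, so that fine is harmless. *)
Definition mean (X : T -> R) : R := fine ('E_P[X])%E.

Definition delta (X Y : T -> R) : R :=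
  mean (fun w => X w * Y w)
  / Num.sqrt (mean (fun w => X w ^+ 2) * mean (fun w => Y w ^+ 2)).

Definition rho_JS (mu1 mu2 : R) (Theta Phi : T -> R) : R :=
  mean (fun w => sin (Theta w - mu1) * sin (Phi w - mu2))
  / Num.sqrt (mean (fun w => sin (Theta w - mu1) ^+ 2)
              * mean (fun w => sin (Phi w - mu2) ^+ 2)).

End coefficients.

(* The i.i.d. copies of (Theta, Phi) are (Theta, Phi) \o fst and
   (Theta, Phi) \o snd on the product probability space P \x P:
   see product_copies_iid. *)
Definition rho_FL {d : measure_display} {T : measurableType d} {R : realType}
    (P : probability T R) (Theta Phi : T -> R) : R :=
  let PP : probability (T * T)%type R := (P \x P)%E in
  mean PP (fun w => sin (Theta w.1 - Theta w.2) * sin (Phi w.1 - Phi w.2))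
  / Num.sqrt (mean PP (fun w => sin (Theta w.1 - Theta w.2) ^+ 2)
              * mean PP (fun w => sin (Phi w.1 - Phi w.2) ^+ 2)).

Lemma product_copies_iid {d : measure_display} {T : measurableType d}
    {R : realType} (P : probability T R) (Theta Phi : {RV P >-> R})
    (A B : set (R * R)) (mA : measurable A) (mB : measurable B) :
  let X w := (Theta w, Phi w) in
  [/\ (P \x P)%E [set w | A (X w.1)] = P [set w | A (X w)],
      (P \x P)%E [set w | A (X w.2)] = P [set w | A (X w)] &
      (P \x P)%E [set w | A (X w.1) /\ B (X w.2)] =
      ((P \x P)%E [set w | A (X w.1)] * (P \x P)%E [set w | B (X w.2)])%E].
Proof.
move=> X.
have mX : measurable_fun setT X.
  by apply/measurable_fun_pairP; split; exact: measurable_funPT.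
have mXpre C : measurable C -> measurable [set w | C (X w)].
  by move=> mC; rewrite -[U in measurable U]setTI; exact: mX.
have e1 C : measurable C -> (P \x P)%E [set w | C (X w.1)] = P [set w | C (X w)].
  move=> mC; have -> : [set w : T * T | C (X w.1)] = [set w | C (X w)] `*` setT.
    by apply/seteqP; split=> [w /= ?|w /= [//]].
  rewrite product_measure1E//; last exact: mXpre.
  by rewrite -[RHS]mule1; congr (_ * _)%E; exact: probability_setT.
have e2 C : measurable C -> (P \x P)%E [set w | C (X w.2)] = P [set w | C (X w)].
  move=> mC; have -> : [set w : T * T | C (X w.2)] = setT `*` [set w | C (X w)].
    by apply/seteqP; split=> [w /= ?|w /= [//]].
  rewrite product_measure1E//; last exact: mXpre.
  by rewrite -[RHS]mul1e; congr (_ * _)%E; exact: probability_setT.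
split; [exact: e1|exact: e2|].
by rewrite e1// e2// -[RHS]product_measure1E//; exact: mXpre.
Qed.

(* Main.v *)
(** Write a = Theta - mu1 and b = Phi - mu2. Expanding the sines of differences
    and using independence of the two copies,
      E[sin(a1-a2) sin(b1-b2)]
        = 2 (E[sin a sin b] E[cos a cos b] - E[sin a cos b] E[cos a sin b]),
      E[sin(a1-a2)^2] = 2 (E[sin^2 a] E[cos^2 a] - E[sin a cos a]^2).
    Both von Mises densities are invariant under (a, b) -> (-a, -b), and since
    they are 2 pi-periodic in each variable this is a symmetry of the law on the
    torus. Hence E[sin a cos b], E[cos a sin b], E[sin a cos a] and
    E[sin b cos b] vanish, and rho_FL factors. The inequality is then
    Cauchy-Schwarz for (cos a, cos b). *)

From HB Require Import structures.
Require Import Defs.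
From mathcomp Require Import all_boot all_order all_algebra.
From mathcomp Require Import all_classical all_reals all_analysis.
From mathcomp Require Import measurable_realfun.
From mathcomp Require Import ring lra.

Import Order.TTheory GRing.Theory Num.Theory.
Import numFieldNormedType.Exports.

Local Open Scope classical_set_scope.
Local Open Scope ring_scope.

(** * Integrals over a period *)

Section period_integral.
Context {R : realType}.
Notation leb := (@lebesgue_measure R).
Implicit Types (h : R -> R) (a b t : R).

Lemma integral_itv_shift h a b t : continuous h -> a <= b ->
  (\int[leb]_(x in `[(a + t)%R, (b + t)%R[) (h x)%:E =
   \int[leb]_(x in `[a, b[) (h (x + t)%R)%:E)%E.
Proof.
move=> hc ab.
have htc : continuous (fun x => h (x + t)).
  move=> x; apply: (@continuous_comp _ _ _ (fun y => y + t) h); last exact: hc.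
  by apply: continuousD => //; exact: cvg_cst.
have mc (g : R -> R) (D : set R) : continuous g -> measurable_fun D (EFin \o g).
  move=> gc; apply/measurable_EFinP; apply: measurable_funTS.
  exact: continuous_measurable_fun.
(* The substitution theorem is applied on closed intervals; adding the right endpoint changes
   neither integral. *)
rewrite !integral_itv_bndo_bndc; [|exact: mc|exact: mc].
have shiftc : continuous (fun x : R => x + t).
  by move=> x; apply: continuousD => //; exact: cvg_cst.
have D1 : derive1 (fun x : R => x + t) = cst 1.
  by apply/funext => x; rewrite derive1E deriveD// derive_id derive_cst addr0.
have := @integration_by_substitution_increasing R (fun x => x + t) h a b ab.
rewrite D1 => -> //.
- by apply: eq_integral => x _; rewrite /= !fctE mulr1.
- by move=> x y _ _; rewrite ltrD2r.
- by move=> x _; exact: cvg_cst.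
- exact: is_cvg_cst.
- exact: is_cvg_cst.
- split.
  + by move=> x _; exact: derivableD.
  + by apply: cvg_at_right_filter; exact: shiftc.
  + by apply: cvg_at_left_filter; exact: shiftc.
- exact: continuous_subspaceT.
Qed.

Lemma integral_itv_split h a b t : continuous h -> (forall x, 0 <= h x) ->
  a <= b -> b <= t ->
  (\int[leb]_(x in `[a, t[) (h x)%:E =
   \int[leb]_(x in `[a, b[) (h x)%:E + \int[leb]_(x in `[b, t[) (h x)%:E)%E.
Proof.
move=> hc h0 ab bt.
have mh (D : set R) : measurable_fun D (EFin \o h).
  apply/measurable_EFinP; apply: measurable_funTS.
  exact: continuous_measurable_fun.
rewrite (@itv_bndbnd_setU _ _ _ (BLeft b))// ge0_integral_setU//=.
- exact: mh.
- by move=> x _; rewrite lee_fin.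
- apply/disj_setPS => x [] /=; rewrite !in_itv/= => /andP[_ xb] /andP[bx _].
  by move: (lt_le_trans xb bx); rewrite ltxx.
Qed.

(** The two windows overlap in [[b, a + p[]. What is left of the first is [[a, b[], and translating
    it by the period [p] gives what is left of the second. *)
Lemma integral_period h p a b : continuous h -> (forall x, 0 <= h x) ->
  periodic h p -> a <= b -> b <= a + p ->
  (\int[leb]_(x in `[a, (a + p)%R[) (h x)%:E =
   \int[leb]_(x in `[b, (b + p)%R[) (h x)%:E)%E.
Proof.
move=> hc h0 hp ab bap.
rewrite (@integral_itv_split h a b)// addeC.
rewrite (@integral_itv_split h b (a + p) (b + p)) ?lerD2r//.
congr (_ + _)%E; rewrite integral_itv_shift//.
by apply: eq_integral => x _; rewrite hp.
Qed.

(** The substitution [x -> - x] turns [h (m - x)] into [h (m + x)] on the same window up to an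
    endpoint. Since [m + x = (x + 2m) - m], this is the integral of [h (x - m)] over the window
    translated by [2m], which is again a full period. *)
Lemma integral_period_reflect h m : continuous h -> (forall x, 0 <= h x) ->
  periodic h (pi *+ 2) -> - pi <= m < pi ->
  (\int[leb]_(x in `[(- pi)%R, pi[) (h (x - m))%:E =
   \int[leb]_(x in `[(- pi)%R, pi[) (h (m - x))%:E)%E.
Proof.
move=> hc h0 hp /andP[pm mp].
have pi0 : 0 <= pi :> R := pi_ge0 R.
have Epi : pi = - pi + pi *+ 2 :> R by rewrite mulr2n; lra.
have hNc (c : R) : continuous (fun x => h (c - x)).
  move=> x; apply: (@continuous_comp _ _ _ (fun y => c - y) h); last exact: hc.
  by apply: continuousB => //; exact: cvg_cst.
have hmc (c : R) : continuous (fun x => h (x - c)).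
  move=> x; apply: (@continuous_comp _ _ _ (fun y => y - c) h); last exact: hc.
  by apply: continuousB => //; exact: cvg_cst.
have mE (g : R -> R) (D : set R) : continuous g -> measurable_fun D (EFin \o g).
  move=> gc; apply/measurable_EFinP; apply: measurable_funTS.
  exact: continuous_measurable_fun.
have -> : (\int[leb]_(x in `[(- pi)%R, pi[) (h (m - x))%:E =
  \int[leb]_(x in `[(- pi)%R, pi[) (h (m + x))%:E)%E.
  rewrite integral_itv_bndo_bndc; last exact: mE.
  have := @integration_by_substitution_oppr R (fun x => h (m - x)) (- pi) pi.
  rewrite opprK => ->; last 2 first.
  - lra.
  - exact: continuous_subspaceT.
  under eq_integral do rewrite /= opprK.
  rewrite integral_itv_bndo_bndc//.
  have -> : (fun x => (h (m + x))%:E) = EFin \o (fun x => h (x - (- m))).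
    by apply/funext => x /=; rewrite opprK addrC.
  exact: mE.
have -> : (\int[leb]_(x in `[(- pi)%R, pi[) (h (m + x))%:E =
  \int[leb]_(x in `[(- pi + m *+ 2)%R, (pi + m *+ 2)%R[) (h (x - m))%:E)%E.
  rewrite integral_itv_shift//; last lra.
  by apply: eq_integral => x _; congr (h _)%:E; rewrite mulr2n; lra.
have hpm : periodic (fun x => h (x - m)) (pi *+ 2).
  by move=> x; rewrite addrAC hp.
have -> : (pi + m *+ 2 = (- pi + m *+ 2) + pi *+ 2 :> R)%R by rewrite !mulr2n; lra.
rewrite {2}Epi.
(* The sign of [m] decides which window lies to the left. The range of [m] bounds the translation
   [2m] by one period, as [integral_period] requires. *)
have [m0|m0] := leP 0 m.
  by apply: (@integral_period (fun x => h (x - m))) => //; rewrite !mulr2n; lra.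
by apply/esym/(@integral_period (fun x => h (x - m))) => //; rewrite !mulr2n; lra.
Qed.

End period_integral.

(** * Integration against a density *)

Section density.
Context d (T : measurableType d) (R : realType).
Variables (nu mu : {measure set T -> \bar R}) (g : T -> \bar R).
Hypothesis mg : measurable_fun setT g.
Hypothesis g0 : forall x, (0 <= g x)%E.
Hypothesis nuE : forall A, measurable A -> nu A = (\int[mu]_(x in A) g x)%E.

Import HBNNSimple.
Local Open Scope ereal_scope.

(** A simple function is a finite combination of indicators of its level sets, and for an indicator
    the identity is [nuE]. *)
Let nnsfun_integral_density (h : {nnsfun T >-> R}) :
  \int[nu]_x (h x)%:E = \int[mu]_x ((h x)%:E * g x).
Proof.
have mh r : measurable_fun setT (fun x => (r * \1_(h @^-1` [set r]) x)%:E).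
  by apply/measurable_EFinP; exact: measurable_funM.
under eq_integral do rewrite fimfunE -fsumEFin//.
rewrite ge0_integral_fsum//; last by move=> r x _; exact: nnfun_muleindic_ge0.
transitivity (\int[mu]_x (\sum_(r \in range h)
    (r * \1_(h @^-1` [set r]) x)%:E * g x)); last first.
  apply: eq_integral => x _.
  rewrite -ge0_mule_fsuml => [|r]; last exact: nnfun_muleindic_ge0.
  by rewrite fsumEFin// -fimfunE.
rewrite ge0_integral_fsum//; last 2 first.
- by move=> r; exact: emeasurable_funM.
- by move=> r x _; rewrite mule_ge0// nnfun_muleindic_ge0.
apply: eq_fsbigr => r rh.
under eq_integral do rewrite EFinM.
rewrite integralZl_indic_nnsfun//.
under [RHS]eq_integral do rewrite EFinM -muleA.
rewrite ge0_integralZl//.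
- rewrite integral_indic// setIT nuE//.
  rewrite integral_mkcond; congr (_ * _).
  by apply: eq_integral => x _; rewrite epatch_indic muleC.
- by apply: emeasurable_funM => //; exact/measurable_EFinP.
- by move=> x _; rewrite mule_ge0// lee_fin.
- by move: rh; rewrite inE => -[x _ <-]; rewrite lee_fin.
Qed.

(** Monotone convergence on both sides extends the case of simple functions. Finiteness of [g] lets
    the pointwise limit pass through multiplication by [g]. *)
Lemma ge0_integral_density (f : T -> \bar R) : measurable_fun setT f ->
  (forall x, 0 <= f x) -> (forall x, g x \is a fin_num) ->
  \int[nu]_x f x = \int[mu]_x (f x * g x).
Proof.
move=> mf f0 gfin; pose h := nnsfun_approx measurableT mf.
have fE x : f x = lim ((EFin \o h n) x @[n --> \oo]).
  by apply/esym/cvg_lim => //; exact: cvg_nnsfun_approx.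
have fgE x : f x * g x = lim (((EFin \o h n) \* g) x @[n --> \oo]).
  by apply/esym/cvg_lim => //; apply: cvgeZr => //; exact: cvg_nnsfun_approx.
under eq_integral do rewrite fE.
under [RHS]eq_integral do rewrite fgE.
rewrite !monotone_convergence//.
- by under eq_fun do rewrite nnsfun_integral_density.
- by move=> n; apply: emeasurable_funM => //; exact/measurable_EFinP.
- by move=> n x _ /=; rewrite mule_ge0// lee_fin.
- by move=> x _ a b ab /=; rewrite lee_wpmul2r// lee_fin; exact/lefP/nd_nnsfun_approx.
- by move=> n; exact/measurable_EFinP.
- by move=> n x _ /=; rewrite lee_fin.
- by move=> x _ a b ab /=; rewrite lee_fin; exact/lefP/nd_nnsfun_approx.
Qed.

End density.

(** * Means of bounded variables *)

Section bounded_mean.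
Context d (T : measurableType d) (R : realType) (P : probability T R).
Implicit Types X Y : T -> R.

(** On a probability space these variables are integrable, so [mean] is linear on them. The class is
    stable under sums and products, hence contains every polynomial in the sines and cosines of the
    angles. *)
Definition bounded_measurable X :=
  measurable_fun setT X /\ exists M, forall w, `|X w| <= M.

Lemma bounded_measurableM X Y : bounded_measurable X -> bounded_measurable Y ->
  bounded_measurable (fun w => X w * Y w).
Proof.
move=> [mX [M XM]] [mY [N YN]]; split; first exact: measurable_funM.
by exists (M * N) => w; rewrite normrM ler_pM.
Qed.

Lemma bounded_measurableD X Y : bounded_measurable X -> bounded_measurable Y ->
  bounded_measurable (fun w => X w + Y w).
Proof.
move=> [mX [M XM]] [mY [N YN]]; split; first exact: measurable_funD.
by exists (M + N) => w; rewrite (le_trans (ler_normD _ _))// lerD.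
Qed.

Lemma bounded_measurable_cst r : bounded_measurable (fun=> r).
Proof. by split; [exact: measurable_cst|exists `|r|]. Qed.

Lemma bounded_measurableN X : bounded_measurable X ->
  bounded_measurable (fun w => - X w).
Proof.
move=> [mX [M XM]]; split; first exact: measurableT_comp.
by exists M => w; rewrite normrN.
Qed.

Lemma bounded_measurableB X Y : bounded_measurable X -> bounded_measurable Y ->
  bounded_measurable (fun w => X w - Y w).
Proof.
by move=> bX bY; apply: bounded_measurableD => //; exact: bounded_measurableN.
Qed.

Lemma bounded_measurable_sqr X : bounded_measurable X ->
  bounded_measurable (fun w => X w ^+ 2).
Proof. by move=> bX; exact: bounded_measurableM. Qed.

Lemma bounded_measurable_shift (f : R -> R) (Y : {RV P >-> R}) m :
  continuous f -> (forall x, `|f x| <= 1) ->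
  bounded_measurable (fun w => f (Y w - m)).
Proof.
move=> cf f1; split; last by exists 1.
apply: (measurableT_comp (continuous_measurable_fun cf)).
exact: measurable_funB.
Qed.

Lemma bounded_measurable_integrable X : bounded_measurable X ->
  P.-integrable setT (EFin \o X).
Proof.
move=> [mX [M XM]]; apply: measurable_bounded_integrable => //.
  by apply: (le_lt_trans (probability_le1 P measurableT)); exact: ltry.
exists M; split; first exact: num_real.
by move=> r Mr w _; exact: le_trans (XM w) (ltW Mr).
Qed.

(** Since the integral is finite, [fine] loses nothing: equalities of means may be proved on
    extended-real integrals. *)
Lemma EFin_mean X : bounded_measurable X ->
  ((mean P X)%:E = \int[P]_w (X w)%:E)%E.
Proof.
move=> /bounded_measurable_integrable iX; rewrite /mean unlock fineK//.
exact: integrable_fin_num.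
Qed.

Lemma mean_cst r : mean P (fun=> r) = r.
Proof. by rewrite /mean (expectation_cst P r). Qed.

Lemma meanD X Y : bounded_measurable X -> bounded_measurable Y ->
  mean P (fun w => X w + Y w) = mean P X + mean P Y.
Proof.
move=> /bounded_measurable_integrable iX /bounded_measurable_integrable iY.
by rewrite /mean unlock; exact: RintegralD.
Qed.

Lemma meanB X Y : bounded_measurable X -> bounded_measurable Y ->
  mean P (fun w => X w - Y w) = mean P X - mean P Y.
Proof.
move=> /bounded_measurable_integrable iX /bounded_measurable_integrable iY.
by rewrite /mean unlock; exact: RintegralB.
Qed.

Lemma meanZ r X : bounded_measurable X ->
  mean P (fun w => r * X w) = r * mean P X.
Proof.
move=> /bounded_measurable_integrable iX.
by rewrite /mean unlock; exact: RintegralZl.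
Qed.

Lemma mean_ge0 X : (forall w, 0 <= X w) -> 0 <= mean P X.
Proof. by move=> X0; rewrite /mean fine_ge0// expectation_ge0. Qed.

(** The second moment of [X + t Y] is a nonnegative quadratic polynomial in [t]; suitable values of
    [t] give the bound. *)
Lemma mean_Cauchy_Schwarz X Y : bounded_measurable X -> bounded_measurable Y ->
  mean P (fun w => X w * Y w) ^+ 2
    <= mean P (fun w => X w ^+ 2) * mean P (fun w => Y w ^+ 2).
Proof.
move=> bX bY.
set A := mean P (fun w => X w ^+ 2); set B := mean P (fun w => Y w ^+ 2).
set C := mean P _.
have quad t : 0 <= A + 2 * t * C + t ^+ 2 * B.
  rewrite /A /B /C -!meanZ -?meanD; try by
    do ?[exact: bounded_measurable_sqr | exact: bounded_measurableM |
         apply: bounded_measurableD | apply: bounded_measurableM |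
         exact: bounded_measurable_cst].
  apply: mean_ge0 => w.
  by rewrite (_ : _ + _ = (X w + t * Y w) ^+ 2) ?sqr_ge0//; ring.
have A0 : 0 <= A by apply: mean_ge0 => w; exact: sqr_ge0.
have B0 : 0 <= B by apply: mean_ge0 => w; exact: sqr_ge0.
have [B00|B00] := eqVneq B 0.
  have [->|C0] := eqVneq C 0; first by rewrite expr0n mulr_ge0.
  (* With [B = 0] the polynomial is affine in [t]; this [t] would give it the value [-1]. *)
  have := quad (- (A + 1) / (2 * C)); rewrite B00 mulr0 addr0.
  have -> : 2 * (- (A + 1) / (2 * C)) * C = - (A + 1) by field.
  by move=> ?; exfalso; lra.
have Bp : 0 < B by rewrite lt_def B00.
(* This is the minimiser of the quadratic polynomial. *)
have := quad (- C / B).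
have -> : A + 2 * (- C / B) * C + (- C / B) ^+ 2 * B = (A * B - C ^+ 2) / B.
  by field.
by rewrite pmulr_lge0 ?invr_gt0// subr_ge0.
Qed.

End bounded_mean.

Arguments bounded_measurable {d T R} X.

(** * Moments of two independent copies *)

Section product_mean.
Context d (T : measurableType d) (R : realType) (P : probability T R).
Implicit Types X Y : T -> R.

Let PP : probability (T * T)%type R := (P \x P)%E.

Lemma bounded_measurable_fst X : bounded_measurable X ->
  bounded_measurable (fun w : T * T => X w.1).
Proof.
move=> [mX [M XM]]; split; last by exists M.
exact: measurableT_comp mX (@measurable_fst _ _ T T).
Qed.

Lemma bounded_measurable_snd X : bounded_measurable X ->
  bounded_measurable (fun w : T * T => X w.2).
Proof.
move=> [mX [M XM]]; split; last by exists M.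
exact: measurableT_comp mX (@measurable_snd _ _ T T).
Qed.

(** This is independence of the two coordinates, obtained from Fubini's theorem: [X x] leaves the
    inner integral and the mean of [Y] leaves the outer one. *)
Lemma mean_product X Y : bounded_measurable X -> bounded_measurable Y ->
  mean PP (fun w => X w.1 * Y w.2) = mean P X * mean P Y.
Proof.
move=> bX bY; apply: EFin_inj.
have bXY : bounded_measurable (fun w : T * T => X w.1 * Y w.2).
  apply: bounded_measurableM; first exact: bounded_measurable_fst.
  exact: bounded_measurable_snd.
rewrite EFin_mean// -(@integral12_prod_meas1 _ _ T T R P P); last first.
  exact: (@bounded_measurable_integrable _ _ _ PP).
transitivity (\int[P]_x ((X x)%:E * (mean P Y)%:E))%E.
  apply: eq_integral => x _; rewrite EFin_mean//.
  rewrite -integralZl//; exact: bounded_measurable_integrable.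
rewrite integralZr//; last exact: bounded_measurable_integrable.
by rewrite -EFin_mean// EFinM.
Qed.

(** The case of size 2 of Andréief's identity. Each factor is a determinant in the two copies; the
    expanded product has four terms, each a function of the first copy times one of the second, and
    they agree in pairs after taking means. With sines and cosines, the determinants are sines of
    differences. *)
Lemma mean_product_det X1 Y1 X2 Y2 :
  bounded_measurable X1 -> bounded_measurable Y1 ->
  bounded_measurable X2 -> bounded_measurable Y2 ->
  mean PP (fun w => (X1 w.1 * Y1 w.2 - Y1 w.1 * X1 w.2)
                    * (X2 w.1 * Y2 w.2 - Y2 w.1 * X2 w.2))
  = 2 * (mean P (fun w => X1 w * X2 w) * mean P (fun w => Y1 w * Y2 w)
         - mean P (fun w => X1 w * Y2 w) * mean P (fun w => Y1 w * X2 w)).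
Proof.
move=> bX1 bY1 bX2 bY2.
pose E X Y (w : T * T) := X w.1 * Y w.2.
have bE X Y : bounded_measurable X -> bounded_measurable Y ->
    bounded_measurable (E X Y).
  move=> bX bY; apply: bounded_measurableM; first exact: bounded_measurable_fst.
  exact: bounded_measurable_snd.
have bM X Y : bounded_measurable X -> bounded_measurable Y ->
    bounded_measurable (fun w => X w * Y w) by exact: bounded_measurableM.
pose XX w := X1 w * X2 w; pose YY w := Y1 w * Y2 w.
pose XY w := X1 w * Y2 w; pose YX w := Y1 w * X2 w.
rewrite (_ : mean PP _ = mean PP (fun w => (E XX YY w + E YY XX w)
                                          - (E XY YX w + E YX XY w))); last first.
  by congr (mean PP _); apply/funext => w; rewrite /E /XX /YY /XY /YX; ring.
rewrite meanB ?meanD; try by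
  do ?[apply: bounded_measurableD | apply: bE | exact: bM].
rewrite !mean_product; try exact: bM.
by rewrite -/XX -/YY -/XY -/YX; ring.
Qed.

End product_mean.

(** * Reflection of the torus *)

Section product_set.
Context d1 d2 (T1 : measurableType d1) (T2 : measurableType d2) (R : realType).
Variables (m1 : {sigma_finite_measure set T1 -> \bar R}).
Variables (m2 : {sigma_finite_measure set T2 -> \bar R}).
Variables (A : set T1) (B : set T2) (f : T1 * T2 -> \bar R).
Hypotheses (mA : measurable A) (mB : measurable B).
Hypotheses (mf : measurable_fun setT f) (f0 : forall z, (0 <= f z)%E).

Let fAB := f \_ (A `*` B).

Let mfAB : measurable_fun setT fAB.
Proof.
apply/(measurable_restrictT f); first exact: measurableX.
exact: measurable_funTS.
Qed.

Let fAB0 z : (0 <= fAB z)%E.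
Proof. by rewrite /fAB patchE; case: ifPn. Qed.

Let fABE x y : fAB (x, y) = (if x \in A then if y \in B then f (x, y) else 0 else 0)%E.
Proof. by rewrite /fAB patchE in_setX /=; case: (x \in A). Qed.

(** The integrand is extended by zero off the rectangle, and Tonelli's theorem is applied on the
    whole product space. *)
Lemma integral_setX :
  (\int[m1 \x m2]_(z in A `*` B) f z =
   \int[m1]_(x in A) \int[m2]_(y in B) f (x, y))%E.
Proof.
rewrite integral_mkcond -/fAB fubini_tonelli1// [RHS]integral_mkcond.
apply: eq_integral => x _; rewrite /fubini_F patchE.
case: ifPn => xA; last by rewrite integral0_eq// => y _; rewrite fABE (negbTE xA).
rewrite [RHS]integral_mkcond; apply: eq_integral => y _.
by rewrite fABE xA patchE.
Qed.

(** With both orders of integration at hand, either variable can be the inner one, where a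
    one-dimensional substitution applies. *)
Lemma integral_setX_swap :
  (\int[m1 \x m2]_(z in A `*` B) f z =
   \int[m2]_(y in B) \int[m1]_(x in A) f (x, y))%E.
Proof.
rewrite integral_mkcond -/fAB fubini_tonelli2// [RHS]integral_mkcond.
apply: eq_integral => y _; rewrite /fubini_G patchE.
case: ifPn => yB; last first.
  by rewrite integral0_eq// => x _; rewrite fABE (negbTE yB) if_same.
rewrite [RHS]integral_mkcond; apply: eq_integral => x _.
by rewrite fABE yB patchE.
Qed.

End product_set.

(** * Doubly periodic functions and their reflection *)

Section torus.
Context {R : realType}.
Notation leb := (@lebesgue_measure R).
Implicit Types F K : R -> R -> R.

(* Separate continuity is what the one-dimensional substitutions use; joint
   measurability is what Tonelli's theorem uses. *)
Record torus_fun F : Prop := TorusFun {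
  torus_measurable : measurable_fun setT (fun z : R * R => F z.1 z.2) ;
  torus_continuousr : forall x, continuous (F x) ;
  torus_continuousl : forall y, continuous (F ^~ y) ;
  torus_periodicr : forall x, periodic (F x) (pi *+ 2) ;
  torus_periodicl : forall y, periodic (F ^~ y) (pi *+ 2) }.

Lemma torus_fun_cst r : torus_fun (fun _ _ => r).
Proof. by split=> // *; exact: cst_continuous. Qed.

Lemma torus_funM F K : torus_fun F -> torus_fun K ->
  torus_fun (fun x y => F x y * K x y).
Proof.
move=> [mF Fr Fl pr pl] [mK Kr Kl qr ql]; split.
- exact: measurable_funM.
- by move=> x y; apply: continuousM; [exact: Fr|exact: Kr].
- by move=> y x; apply: continuousM; [exact: Fl|exact: Kl].
- by move=> x y; rewrite pr qr.
- by move=> y x; rewrite pl ql.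
Qed.

Lemma torus_funD F K : torus_fun F -> torus_fun K ->
  torus_fun (fun x y => F x y + K x y).
Proof.
move=> [mF Fr Fl pr pl] [mK Kr Kl qr ql]; split.
- exact: measurable_funD.
- by move=> x y; apply: continuousD; [exact: Fr|exact: Kr].
- by move=> y x; apply: continuousD; [exact: Fl|exact: Kl].
- by move=> x y; rewrite pr qr.
- by move=> y x; rewrite pl ql.
Qed.

Lemma torus_fun_fst (p : R -> R) : continuous p -> periodic p (pi *+ 2) ->
  torus_fun (fun x _ => p x).
Proof.
move=> cp pp; split=> //.
- apply: (measurableT_comp (continuous_measurable_fun cp)).
  exact: measurable_fst.
- by move=> x; exact: cst_continuous.
Qed.

Lemma torus_fun_snd (p : R -> R) : continuous p -> periodic p (pi *+ 2) ->
  torus_fun (fun _ y => p y).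
Proof.
move=> cp pp; split=> //.
- apply: (measurableT_comp (continuous_measurable_fun cp)).
  exact: measurable_snd.
- by move=> y; exact: cst_continuous.
Qed.

Lemma torus_fun_expR F : torus_fun F -> torus_fun (fun x y => expR (F x y)).
Proof.
move=> [mF Fr Fl pr pl]; split.
- exact: measurableT_comp.
- move=> x y; apply: (@continuous_comp _ _ _ (F x) expR); first exact: Fr.
  exact: continuous_expR.
- move=> y x; apply: (@continuous_comp _ _ _ (F ^~ y) expR); first exact: Fl.
  exact: continuous_expR.
- by move=> x y; rewrite pr.
- by move=> y x; rewrite pl.
Qed.

Lemma torus_funN F : torus_fun F -> torus_fun (fun x y => F (- x) (- y)).
Proof.
have perN (h : R -> R) : periodic h (pi *+ 2) -> periodic (h \o -%R) (pi *+ 2).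
  by move=> hp x /=; rewrite opprD -[LHS]hp subrK.
have cN (h : R -> R) : continuous h -> continuous (h \o -%R).
  by move=> ch x; apply: continuous_comp; [exact: continuousN|exact: ch].
move=> [mF Fr Fl pr pl]; split.
- apply: (measurableT_comp mF (g := fun z : R * R => (- z.1, - z.2))).
  by apply: measurable_fun_pair; apply: measurableT_comp;
    [|exact: measurable_fst| |exact: measurable_snd].
- by move=> x; exact: cN.
- by move=> y; exact: (cN (F ^~ (- y))).
- by move=> x; exact: perN.
- by move=> y; exact: (perN (F ^~ (- y))).
Qed.

(** One variable is reflected at a time, always as the inner variable of an iterated integral, by
    [integral_period_reflect]. *)
Lemma torus_integral_reflect F m1 m2 : torus_fun F ->
  (forall x y, 0 <= F x y) -> - pi <= m1 < pi -> - pi <= m2 < pi ->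
  (\int[leb \x leb]_(z in torus_square) (F (z.1 - m1) (z.2 - m2))%:E =
   \int[leb \x leb]_(z in torus_square) (F (m1 - z.1) (m2 - z.2))%:E)%E.
Proof.
move=> [mF Fr Fl pr pl] F0 hm1 hm2.
have mcomp (f g : R -> R) : continuous f -> continuous g ->
    measurable_fun setT (fun z : R * R => (F (f z.1) (g z.2))%:E).
  move=> cf cg; apply/measurable_EFinP.
  apply: (measurableT_comp mF (g := fun z : R * R => (f z.1, g z.2))).
  apply: measurable_fun_pair.
    by apply: (measurableT_comp (continuous_measurable_fun cf)); exact: measurable_fst.
  by apply: (measurableT_comp (continuous_measurable_fun cg)); exact: measurable_snd.
have F0E (f g : R -> R) (z : R * R) : (0 <= (F (f z.1) (g z.2))%:E)%E.
  by rewrite lee_fin.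
have mI : measurable (`[- pi, pi[ : set R) by exact: measurable_itv.
have iter (f g : R -> R) : continuous f -> continuous g ->
    (\int[leb \x leb]_(z in torus_square) (F (f z.1) (g z.2))%:E =
     \int[leb]_(x in `[(- pi)%R, pi[) \int[leb]_(y in `[(- pi)%R, pi[)
       (F (f x) (g y))%:E)%E.
  move=> cf cg.
  exact: (integral_setX _ _ _ _ _ leb leb _ _ _ mI mI (mcomp f g cf cg) (F0E f g)).
have iter_swap (f g : R -> R) : continuous f -> continuous g ->
    (\int[leb \x leb]_(z in torus_square) (F (f z.1) (g z.2))%:E =
     \int[leb]_(y in `[(- pi)%R, pi[) \int[leb]_(x in `[(- pi)%R, pi[)
       (F (f x) (g y))%:E)%E.
  move=> cf cg.
  exact: (integral_setX_swap _ _ _ _ _ leb leb _ _ _ mI mI (mcomp f g cf cg) (F0E f g)).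
have cr (m : R) : continuous (fun x => m - x).
  by move=> x; apply: continuousB => //; exact: cvg_cst.
have cl (m : R) : continuous (fun x => x - m).
  by move=> x; apply: continuousB => //; exact: cvg_cst.
(* In the intermediate integrand only the second coordinate is reflected. *)
transitivity (\int[leb \x leb]_(z in torus_square)
    (F (z.1 - m1) (m2 - z.2))%:E)%E.
  rewrite (iter (fun x => x - m1) (fun y => y - m2))//.
  rewrite (iter (fun x => x - m1) (fun y => m2 - y))//.
  by apply: eq_integral => x _; apply: (integral_period_reflect (F (x - m1))).
rewrite (iter_swap (fun x => x - m1) (fun y => m2 - y))//.
rewrite (iter_swap (fun x => m1 - x) (fun y => m2 - y))//.
by apply: eq_integral => y _; apply: (integral_period_reflect (F ^~ (m2 - y))).
Qed.

End torus.

(** * Laws with a reflection-invariant density *)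

Section symmetric_law.
Context {d : measure_display} {T : measurableType d} {R : realType}.
Variables (P : probability T R) (Theta Phi : {RV P >-> R}).
Variables (K : R -> R -> R) (m1 m2 : R).
Hypotheses (hm1 : - pi <= m1 < pi) (hm2 : - pi <= m2 < pi).
Hypotheses (tK : torus_fun K) (K0 : forall x y, 0 <= K x y).
Hypothesis (KN : forall x y, K (- x) (- y) = K x y).
Hypothesis law :
  has_density_proportional_to Theta Phi (fun z => K (z.1 - m1) (z.2 - m2)).

Notation leb := (@lebesgue_measure R).

(** The expectation becomes a Lebesgue integral of [F] times the density over the torus, where the
    reflection is available and leaves the even kernel [K] unchanged. *)
Lemma integral_law_reflect (F : R -> R -> R) : torus_fun F ->
  (forall x y, 0 <= F x y) ->
  (\int[P]_w (F (Theta w - m1) (Phi w - m2))%:E =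
   \int[P]_w (F (- (Theta w - m1)) (- (Phi w - m2)))%:E)%E.
Proof.
move=> tF F0; have [c c0 hP] := law.
(* The product Lebesgue measure lives on measurableTypeR R, whose measurable sets
   are those of R but whose display differs. *)
pose X w : measurableTypeR R * measurableTypeR R := (Theta w, Phi w).
have mX : measurable_fun setT X.
  have mX : measurable_fun setT (fun w => (Theta w, Phi w)).
    exact: measurable_fun_pair.
  exact: mX.
pose X' : {mfun T >-> (measurableTypeR R * measurableTypeR R)%type} :=
  HB.pack X (isMeasurableFun.Build _ _ _ _ _ mX).
(* Extending the density by zero off the torus makes it a density on the whole plane, the form used
   by [ge0_integral_density]. *)
pose g := (fun z => (c * K (z.1 - m1) (z.2 - m2))%:E) \_ torus_square.
have mtorus : measurable (@torus_square R) by exact: measurableX.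
have msub (G : R -> R -> R) : torus_fun G ->
    measurable_fun setT (fun z : R * R => G (z.1 - m1) (z.2 - m2)).
  move=> [mG _ _ _ _].
  apply: (measurableT_comp mG (g := fun z : R * R => (z.1 - m1, z.2 - m2))).
  by apply: measurable_fun_pair; apply: measurable_funB.
have mg : measurable_fun setT g.
  apply/(measurable_restrictT _ mtorus)/measurable_funTS/measurable_EFinP.
  by apply: measurable_funM => //; exact: msub.
have g0 z : (0 <= g z)%E.
  by rewrite /g patchE; case: ifPn => // _; rewrite lee_fin mulr_ge0// ltW.
have gfin z : g z \is a fin_num by rewrite /g patchE; case: ifPn.
pose leb2 : {measure set (measurableTypeR R * measurableTypeR R)%type -> \bar R} :=
  (leb \x leb)%E.
have gE A : measurable A -> distribution P X' A = (\int[leb \x leb]_(z in A) g z)%E.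
  by move=> mA; rewrite /g -integral_mkcondr -hP.
(* Transfer to Lebesgue measure: first push [P] forward to the joint distribution, then integrate
   against its density. *)
have key (G : R -> R -> R) : torus_fun G -> (forall x y, 0 <= G x y) ->
    (\int[P]_w (G (Theta w - m1) (Phi w - m2))%:E =
     \int[leb \x leb]_(z in torus_square)
       ((fun x y => c * (G x y * K x y)) (z.1 - m1) (z.2 - m2))%:E)%E.
  move=> tG G0.
  transitivity (\int[distribution P X']_z (G (z.1 - m1) (z.2 - m2))%:E)%E.
    rewrite ge0_integral_distribution//; last by move=> z; rewrite lee_fin.
    by apply/measurable_EFinP; exact: msub.
  rewrite (ge0_integral_density _ _ _ (distribution P X') leb2 g mg g0 gE)//;
    last 2 first.
  - by apply/measurable_EFinP; exact: msub.
  - by move=> z; rewrite lee_fin.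
  rewrite [RHS]integral_mkcond; apply: eq_integral => z _.
  rewrite /g !patchE; case: ifPn => _; last by rewrite mule0.
  by rewrite -EFinM; congr EFin; ring.
rewrite key// (key _ (torus_funN _ tF))//.
rewrite (torus_integral_reflect (fun x y => c * (F x y * K x y)))//.
(* On the right only [F] carries reflected arguments; evenness puts the same signs into [K]. *)
- by apply: eq_integral => z _ /=; rewrite -[in RHS]KN !opprB.
- by apply: torus_funM; [exact: torus_fun_cst|exact: torus_funM].
- by move=> x y; rewrite !mulr_ge0// ltW.
Qed.

(** The reflection preserves the law and changes the sign of the product, so its mean equals its own
    opposite. *)
Lemma mean_odd_law (p q : R -> R) :
  continuous p -> continuous q ->
  periodic p (pi *+ 2) -> periodic q (pi *+ 2) ->
  (forall x, `|p x| <= 1) -> (forall x, `|q x| <= 1) ->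
  (forall x y, p (- x) * q (- y) = - (p x * q y)) ->
  mean P (fun w => p (Theta w - m1) * q (Phi w - m2)) = 0.
Proof.
move=> cp cq pp pq p1 q1 oddpq.
have tpq : torus_fun (fun x y => p x * q y).
  by apply: torus_funM; [exact: torus_fun_fst|exact: torus_fun_snd].
have pq1 x y : `|p x * q y| <= 1 by rewrite normrM mulr_ile1.
set h := fun w => p (Theta w - m1) * q (Phi w - m2).
(* Adding 1 makes the integrand nonnegative, so that Tonelli applies without
   any integrability with respect to Lebesgue measure. *)
have bh : bounded_measurable h by apply: bounded_measurableM;
  exact: bounded_measurable_shift.
have b1 := bounded_measurable_cst _ T R 1.
have : mean P (fun w => 1 + h w) = mean P (fun w => 1 - h w).
  apply: EFin_inj; rewrite !EFin_mean; last 2 first.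
  - exact: bounded_measurableB.
  - exact: bounded_measurableD.
  rewrite (integral_law_reflect (fun x y => 1 + p x * q y)).
  - by apply: eq_integral => w _; rewrite oddpq.
  - exact: torus_funD (torus_fun_cst 1) tpq.
  - by move=> x y; have := pq1 x y; rewrite ler_norml => /andP[+ _]; lra.
by rewrite meanD// meanB// mean_cst; lra.
Qed.

End symmetric_law.

(** * The von Mises laws *)

Section von_mises_kernels.
Context {R : realType}.
Variables k1 k2 k3 : R.

Definition centered_sine_kernel (x y : R) : R :=
  expR (k1 * cos x + k2 * cos y + k3 * sin x * sin y).

(** The cosine of [x - y] is expanded so that the exponent is built from functions of one variable,
    to which the closure properties of [torus_fun] apply. *)
Definition centered_cosine_kernel (x y : R) : R :=
  expR (k1 * cos x + k2 * cos y + k3 * (cos x * cos y + sin x * sin y)).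

Let tc1 := torus_fun_fst cos (@continuous_cos R) (@cosD2pi R).
Let tc2 := torus_fun_snd cos (@continuous_cos R) (@cosD2pi R).
Let ts1 := torus_fun_fst sin (@continuous_sin R) (@sinD2pi R).
Let ts2 := torus_fun_snd sin (@continuous_sin R) (@sinD2pi R).

Lemma torus_fun_centered_sine_kernel : torus_fun centered_sine_kernel.
Proof.
apply: torus_fun_expR; apply: torus_funD; first apply: torus_funD.
- exact: torus_funM (torus_fun_cst k1) tc1.
- exact: torus_funM (torus_fun_cst k2) tc2.
- exact: torus_funM (torus_funM _ _ (torus_fun_cst k3) ts1) ts2.
Qed.

Lemma torus_fun_centered_cosine_kernel : torus_fun centered_cosine_kernel.
Proof.
apply: torus_fun_expR; apply: torus_funD; first apply: torus_funD.
- exact: torus_funM (torus_fun_cst k1) tc1.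
- exact: torus_funM (torus_fun_cst k2) tc2.
- apply: (torus_funM _ _ (torus_fun_cst k3)); apply: torus_funD.
    exact: torus_funM tc1 tc2.
  exact: torus_funM ts1 ts2.
Qed.

Lemma vm_cosine_kernelE mu1 mu2 : vm_cosine_kernel k1 k2 k3 mu1 mu2 =
  fun z => centered_cosine_kernel (z.1 - mu1) (z.2 - mu2).
Proof.
apply/funext => z; rewrite /vm_cosine_kernel /centered_cosine_kernel -cosB.
by congr (expR (_ + _ * cos _)); ring.
Qed.

End von_mises_kernels.

(** The only use of the particular laws: both kernels are even under simultaneous reflection, since
    the sines occur in them only through their product. *)
Lemma von_mises_mean_odd (d : measure_display) (T : measurableType d)
    (R : realType) (P : probability T R) (Theta Phi : {RV P >-> R})
    (mu1 mu2 k1 k2 k3 : R) (p q : R -> R) :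
  - pi <= mu1 < pi -> - pi <= mu2 < pi ->
  von_mises_sine k1 k2 k3 mu1 mu2 Theta Phi
    \/ von_mises_cosine k1 k2 k3 mu1 mu2 Theta Phi ->
  continuous p -> continuous q ->
  periodic p (pi *+ 2) -> periodic q (pi *+ 2) ->
  (forall x, `|p x| <= 1) -> (forall x, `|q x| <= 1) ->
  (forall x y, p (- x) * q (- y) = - (p x * q y)) ->
  mean P (fun w => p (Theta w - mu1) * q (Phi w - mu2)) = 0.
Proof.
move=> hmu1 hmu2 [law|law].
- apply: (mean_odd_law _ _ _ (centered_sine_kernel k1 k2 k3)) => //.
  + exact: torus_fun_centered_sine_kernel.
  + by move=> x y; exact: expR_ge0.
  + by move=> x y; rewrite /centered_sine_kernel !cosN !sinN !mulrN mulNr opprK.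
(* The sine kernel is centered by mere unfolding; the cosine kernel first needs the subtraction
   formula. *)
- move: law; rewrite /von_mises_cosine vm_cosine_kernelE => law.
  apply: (mean_odd_law _ _ _ (centered_cosine_kernel k1 k2 k3)) => //.
  + exact: torus_fun_centered_cosine_kernel.
  + by move=> x y; exact: expR_ge0.
  + by move=> x y; rewrite /centered_cosine_kernel !cosN !sinN mulrNN.
Qed.

(** * Factorisation of the Fisher-Lee coefficient *)

Theorem corollary2p2 (R : realType) (d : measure_display) (T : measurableType d)
    (P : probability T R) (Theta Phi : {RV P >-> R})
    (mu1 mu2 k1 k2 k3 : R)
    (hmu1 : - pi <= mu1 < pi) (hmu2 : - pi <= mu2 < pi)
    (hk1 : 0 <= k1) (hk2 : 0 <= k2)
    (hlaw : von_mises_sine k1 k2 k3 mu1 mu2 Theta Phi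
            \/ von_mises_cosine k1 k2 k3 mu1 mu2 Theta Phi) :
  rho_FL P Theta Phi
    = delta P (fun w => cos (Theta w - mu1)) (fun w => cos (Phi w - mu2))
      * rho_JS P mu1 mu2 Theta Phi
  /\ `|rho_FL P Theta Phi| <= `|rho_JS P mu1 mu2 Theta Phi|.
Proof.
have odd0 p q := von_mises_mean_odd _ _ _ _ _ _ _ _ _ _ _ p q hmu1 hmu2 hlaw.
set s1 := fun w => sin (Theta w - mu1); set c1 := fun w => cos (Theta w - mu1).
set s2 := fun w => sin (Phi w - mu2); set c2 := fun w => cos (Phi w - mu2).
have csin := @continuous_sin R; have ccos := @continuous_cos R.
have bs1 : bounded_measurable s1 by apply: bounded_measurable_shift => //; exact: sin_max.
have bc1 : bounded_measurable c1 by apply: bounded_measurable_shift => //; exact: cos_max.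
have bs2 : bounded_measurable s2 by apply: bounded_measurable_shift => //; exact: sin_max.
have bc2 : bounded_measurable c2 by apply: bounded_measurable_shift => //; exact: cos_max.
have csc : continuous (fun x : R => sin x * cos x).
  by move=> x; apply: continuousM; [exact: csin|exact: ccos].
have psc : periodic (fun x : R => sin x * cos x) (pi *+ 2).
  by move=> x; rewrite sinD2pi cosD2pi.
have sc1 (x : R) : `|sin x * cos x| <= 1.
  by rewrite normrM mulr_ile1// ?sin_max ?cos_max.
have cone : continuous (fun _ : R => 1 : R) by move=> x; exact: cst_continuous.
have E1 : mean P (fun w => s1 w * c2 w) = 0.
  apply: (odd0 sin cos) => //; try by
    [exact: sin_max|exact: cos_max|exact: sinD2pi|exact: cosD2pi].
  by move=> x y; rewrite sinN cosN mulNr.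
have E2 : mean P (fun w => c1 w * s2 w) = 0.
  apply: (odd0 cos sin) => //; try by
    [exact: sin_max|exact: cos_max|exact: sinD2pi|exact: cosD2pi].
  by move=> x y; rewrite sinN cosN mulrN.
have E3 : mean P (fun w => s1 w * c1 w) = 0.
  (* A moment of one angle alone fits the two-angle statement with the constant 1 as the function of
     the other angle. *)
  transitivity (mean P (fun w => s1 w * c1 w * 1)).
    by congr (mean P _); apply/funext => w; rewrite mulr1.
  apply: (odd0 (fun x => sin x * cos x) (fun=> 1)) => // [x|x y].
    by rewrite normr1.
  by rewrite sinN cosN !mulr1 mulNr.
have E4 : mean P (fun w => s2 w * c2 w) = 0.
  transitivity (mean P (fun w => 1 * (s2 w * c2 w))).
    by congr (mean P _); apply/funext => w; rewrite mul1r.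
  apply: (odd0 (fun=> 1) (fun x => sin x * cos x)) => // [x|x y].
    by rewrite normr1.
  by rewrite sinN cosN !mul1r mulNr.
set S1 := mean P (fun w => s1 w ^+ 2); set S2 := mean P (fun w => s2 w ^+ 2).
set C1 := mean P (fun w => c1 w ^+ 2); set C2 := mean P (fun w => c2 w ^+ 2).
set SS := mean P (fun w => s1 w * s2 w); set CC := mean P (fun w => c1 w * c2 w).
have ge0 (X : T -> R) : 0 <= mean P (fun w => X w ^+ 2).
  by apply: mean_ge0 => w; exact: sqr_ge0.
have S10 : 0 <= S1 := ge0 _.
have S20 : 0 <= S2 := ge0 _.
have C10 : 0 <= C1 := ge0 _.
have C20 : 0 <= C2 := ge0 _.
(* The location [m] cancels in the difference, which gives the determinants in centered sines and
   cosines that [mean_product_det] expects. *)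
have shift (x y m : R) : sin (x - y)
    = sin (x - m) * cos (y - m) - cos (x - m) * sin (y - m).
  by rewrite -sinB; congr sin; ring.
have FL : rho_FL P Theta Phi =
    2 * (SS * CC) / Num.sqrt (2 * (S1 * C1) * (2 * (S2 * C2))).
  rewrite /rho_FL.
  have -> : (fun w : T * T =>
      sin (Theta w.1 - Theta w.2) * sin (Phi w.1 - Phi w.2)) =
      (fun w => (s1 w.1 * c1 w.2 - c1 w.1 * s1 w.2)
                * (s2 w.1 * c2 w.2 - c2 w.1 * s2 w.2)).
    by apply/funext => w; rewrite (shift _ _ mu1) (shift (Phi _) _ mu2).
  have -> : (fun w : T * T => sin (Theta w.1 - Theta w.2) ^+ 2) =
      (fun w => (s1 w.1 * c1 w.2 - c1 w.1 * s1 w.2)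
                * (s1 w.1 * c1 w.2 - c1 w.1 * s1 w.2)).
    by apply/funext => w; rewrite (shift _ _ mu1) expr2.
  have -> : (fun w : T * T => sin (Phi w.1 - Phi w.2) ^+ 2) =
      (fun w => (s2 w.1 * c2 w.2 - c2 w.1 * s2 w.2)
                * (s2 w.1 * c2 w.2 - c2 w.1 * s2 w.2)).
    by apply/funext => w; rewrite (shift _ _ mu2) expr2.
  (* In each of the three determinants of moments the off-diagonal product has a vanishing factor,
     so the diagonal alone remains. *)
  by rewrite !mean_product_det// E1 E3 E4 !mul0r !subr0.
have FLE : rho_FL P Theta Phi = delta P c1 c2 * rho_JS P mu1 mu2 Theta Phi.
  rewrite FL /delta /rho_JS -/S1 -/S2 -/C1 -/C2 -/SS -/CC.
  (* The two factors 2 form a square, which leaves the root as a single 2 and cancels the one in the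
     numerator. *)
  have -> : 2 * (S1 * C1) * (2 * (S2 * C2)) = 2 ^+ 2 * ((C1 * C2) * (S1 * S2)).
    by ring.
  rewrite sqrtrM ?sqr_ge0// sqrtr_sqr ger0_norm// sqrtrM ?mulr_ge0//.
  (* Inversion is multiplicative even at 0, whose inverse is 0, so vanishing second moments need no
     separate case; [field] treats [u] and [v] as atoms. *)
  rewrite !invfM.
  set u := (Num.sqrt (C1 * C2))^-1; set v := (Num.sqrt (S1 * S2))^-1.
  by field.
split=> //; rewrite FLE normrM ler_piMl//.
have CS : CC ^+ 2 <= C1 * C2 by exact: mean_Cauchy_Schwarz.
rewrite /delta -/C1 -/C2 -/CC normrM normfV (ger0_norm (sqrtr_ge0 _)).
(* If the denominator of [delta] vanishes, the quotient is 0 by convention. Otherwise the bound is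
   the square root of [CS]. *)
have [->|C0] := eqVneq (Num.sqrt (C1 * C2)) 0; first by rewrite invr0 mulr0.
rewrite ler_pdivrMr ?lt_def ?C0 ?sqrtr_ge0// mul1r -sqrtr_sqr.
exact: ler_wsqrtr.
Qed.
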